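(* Let $a\le x<x'\le b$ be real numbers, $0<\alpha\le\frac12$, $y=(1-\alpha)x+\alpha x'$, $y'=\alpha x+(1-\alpha)x'$, $\Omega=[x,y]\cup[y',x']$, and let $m'=\frac12$ if $y\ne y'$ and $m'=0$ if $y=y'$. Let $f:[a,b]\to\mathbb{R}$ be convex and let $p:[x,x']\to[0,\infty)$ be integrable and symmetric about $\frac{x+x'}{2}$. Let $G_1,\mathrm{Hp}_1,\mathrm{Hp}_2,\mathrm{Pp}_1,\mathrm{Lp}_1,\mathrm{Ip}_1,\mathrm{Ip}_2,\mathrm{Np},\mathrm{Sp}:[0,1]\to\mathbb{R}$ be the functions defined in the context. Then: (1) For all $t\in[0,1]$, $$0\le \mathrm{Np}(t)-2G_1(t)\int_x^{x'}p(s)\,ds\le[f(x)+f(x')]\int_x^{x'}p(s)\,ds-\mathrm{Np}(t).$$ (2) If $f$ is differentiable on $\Omega$, then for all $t\in[0,1]$ $$0\le \mathrm{Lp}_1(t)-\frac{\mathrm{Hp}_1(t)+\mathrm{Hp}_2(t)}{2}\le\frac{4x'-y-3y'}{8}(f'(x')-f'(x))\int_\Omega p(s)\,ds$$ and $$0\le \mathrm{Pp}_1(t)-\mathrm{Lp}_1(t)\le\frac{4x'-y-3y'}{8}(f'(x')-f'(x))\int_\Omega p(s)\,ds.$$ (3) If $f$ is differentiable on $[x,x']$, then $$0\le \mathrm{Np}(t)-\mathrm{Ip}_1(t)\le(y-x)(f'(x')-f'(x))\int_x^{x'}p(s)\,ds\qquad(t\in[0,1])$$ and $$0\le \mathrm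{Sp}(t)-\frac{\mathrm{Ip}_1(t)+\mathrm{Ip}_2(t)}{2}\le\frac{4x'-y-3y'}{4}(f'(x')-f'(x))\int_x^{x'}p(s)\,ds\qquad(t\in[m',1]).$$
   Context: Symmetric about $\frac{x+x'}{2}$ means $p(s)=p(x+x'-s)$ for $s\in[x,x']$. For $t\in[0,1]$ define $$G_1(t)=\frac12\left[f(tx+(1-t)y)+f(tx'+(1-t)y')\right],$$ $$\mathrm{Hp}_1(t)=\int_x^y\left[f(ts+(1-t)y)+f(t(y+y'-s)+(1-t)y')\right]p(s)\,ds,$$ $$\mathrm{Hp}_2(t)=\int_x^y\left[f(ts+(1-t)y')+f(t(y+y'-s)+(1-t)y)\right]p(s)\,ds,$$ $$\mathrm{Pp}_1(t)=\int_x^y\left[f(tx+(1-t)s)+f(tx'+(1-t)(x+x'-s))\right]p(s)\,ds,$$ $$\mathrm{Lp}_1(t)=\frac12\int_\Omega\left[f(tx+(1-t)s)+f(tx'+(1-t)s)\right]p(s)\,ds,$$ $$\mathrm{Ip}_1(t)=\int_x^{x'}\left[f\big(t((1-\alpha)x+\alpha s)+(1-t)y\big)+f\big(t((1-\alpha)x'+\alpha s)+(1-t)y'\big)\right]p(s)\,ds,$$ $$\mathrm{Ip}_2(t)=\int_x^{x'}\left[f\big(t((1-\alpha)x+\alpha s)+(1-t)y'\big)+f\big(t((1-\alpha)x'+\alpha s)+(1-t)y\big)\right]p(s)\,ds,$$ $$\mathrm{Np}(t)=\int_x^{x'}\left[f\big(tx+(1-t)((1-\alpha)x+\alpha s)\big)+f\big(tx'+(1-t)((1-\alpha)x'+\alpha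 s)\big)\right]p(s)\,ds,$$ $$\begin{aligned}\mathrm{Sp}(t)=\int_x^{x'}\frac12\Big[&f\big(tx+(1-t)((1-\alpha)x+\alpha s)\big)+f\big(tx+(1-t)((1-\alpha)x'+\alpha s)\big)\\&+f\big(tx'+(1-t)((1-\alpha)x+\alpha s)\big)+f\big(tx'+(1-t)((1-\alpha)x'+\alpha s)\big)\Big]p(s)\,ds.\end{aligned}$$ *)

(* Defs.v *)
From mathcomp Require Import all_boot all_order all_algebra.
From mathcomp Require Import all_classical all_reals all_analysis.

Set Implicit Arguments.
Unset Strict Implicit.
Unset Printing Implicit Defensive.

Import Order.TTheory GRing.Theory Num.Theory.
Import numFieldNormedType.Exports.

Local Open Scope classical_set_scope.
Local Open Scope ring_scope.

(* Real-valued integral with respect to the completed (rather than the Borel)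
   Lebesgue measure, so that every Lebesgue-integrable weight, and every
   Riemann-integrable one, is covered. *)
Definition lint {R : realType} (D : set R) (g : R -> R) : R :=
  (\int[@completed_lebesgue_measure R]_(s in D) g s)%R.

Definition lintegrable {R : realType} (D : set R) (g : R -> R) : Prop :=
  (@completed_lebesgue_measure R).-integrable D (EFin \o g).

(* Differentiability relative to a set E: the difference quotient at c is taken
   along the points of E other than c, hence is one-sided at the end points of
   the connected components of E and two-sided at its interior points.  The limit
   is unique when E has no isolated points, e.g. for a union of nondegenerate
   intervals. *)
Definition differentiable_on {R : realType} (E : set R) (f : R -> R) : Prop :=
  forall c, E c -> cvg ((f s - f c) / (s - c) @[s --> within E c^']).

Definition deriv_on {R : realType} (E : set R) (f : R -> R) (c : R) : R :=
  lim ((f s - f c) / (s - c) @[s --> within E c^']).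

Definition symmetric_weight {R : realType} (x x' : R) (p : R -> R) : Prop :=
  forall s, s \in `[x, x'] -> p s = p (x + x' - s).

Definition Omega {R : realType} (x x' y y' : R) : set R :=
  `[x, y] `|` `[y', x'].

Definition G1 {R : realType} (f : R -> R) (x x' y y' t : R) : R :=
  2^-1 * (f (t * x + (1 - t) * y) + f (t * x' + (1 - t) * y')).

Definition Hp1 {R : realType} (f p : R -> R) (x y y' t : R) : R :=
  lint `[x, y] (fun s =>
    (f (t * s + (1 - t) * y) + f (t * (y + y' - s) + (1 - t) * y')) * p s).

Definition Hp2 {R : realType} (f p : R -> R) (x y y' t : R) : R :=
  lint `[x, y] (fun s =>
    (f (t * s + (1 - t) * y') + f (t * (y + y' - s) + (1 - t) * y)) * p s).

Definition Pp1 {R : realType} (f p : R -> R) (x x' y t : R) : R :=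
  lint `[x, y] (fun s =>
    (f (t * x + (1 - t) * s) + f (t * x' + (1 - t) * (x + x' - s))) * p s).

Definition Lp1 {R : realType} (f p : R -> R) (x x' y y' t : R) : R :=
  2^-1 * lint (Omega x x' y y') (fun s =>
    (f (t * x + (1 - t) * s) + f (t * x' + (1 - t) * s)) * p s).

Definition Ip1 {R : realType} (f p : R -> R) (alpha x x' y y' t : R) : R :=
  lint `[x, x'] (fun s =>
    (f (t * ((1 - alpha) * x + alpha * s) + (1 - t) * y)
     + f (t * ((1 - alpha) * x' + alpha * s) + (1 - t) * y')) * p s).

Definition Ip2 {R : realType} (f p : R -> R) (alpha x x' y y' t : R) : R :=
  lint `[x, x'] (fun s =>
    (f (t * ((1 - alpha) * x + alpha * s) + (1 - t) * y')
     + f (t * ((1 - alpha) * x' + alpha * s) + (1 - t) * y)) * p s).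

Definition Np {R : realType} (f p : R -> R) (alpha x x' t : R) : R :=
  lint `[x, x'] (fun s =>
    (f (t * x + (1 - t) * ((1 - alpha) * x + alpha * s))
     + f (t * x' + (1 - t) * ((1 - alpha) * x' + alpha * s))) * p s).

Definition Sp {R : realType} (f p : R -> R) (alpha x x' t : R) : R :=
  lint `[x, x'] (fun s =>
    2^-1 * (f (t * x + (1 - t) * ((1 - alpha) * x + alpha * s))
            + f (t * x + (1 - t) * ((1 - alpha) * x' + alpha * s))
            + f (t * x' + (1 - t) * ((1 - alpha) * x + alpha * s))
            + f (t * x' + (1 - t) * ((1 - alpha) * x' + alpha * s))) * p s).

(* Main.v *)
(** Put c = (x + x')/2 and phi(r) = f(c + r) + f(c - r), an even convex
    function.  Since p is symmetric about c, an integrand may be averaged with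
    its reflection in c, and after this symmetrization every inequality holds
    pointwise between values of phi.  With X = x' - c, Y = y' - c and
    Y <= S <= X, the lower bounds come from the fact that phi is nondecreasing
    on [0, X], together with the weak majorization
      |tX + (1-t)S| + |tX - (1-t)S| >= |tS + (1-t)Y| + |tS - (1-t)Y|;
    the upper bounds of (2) and (3) come from phi being Lipschitz with constant
    f'(x') - f'(x), and the upper bound of (1) from the convexity of phi.
    The weight is only integrable for the completed Lebesgue measure, so the
    reflection invariance of that measure has to be deduced from the Borel
    case by sandwiching measurable sets between Borel sets. *)

Require Import Defs.
From mathcomp Require Import all_boot all_order all_algebra.
From mathcomp Require Import all_classical all_reals all_analysis.
From mathcomp Require Import measurable_realfun ring lra.

Import Order.TTheory GRing.Theory Num.Theory.
Import numFieldNormedType.Exports.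

Local Open Scope classical_set_scope.
Local Open Scope ring_scope.

Set Implicit Arguments.
Unset Strict Implicit.
Unset Printing Implicit Defensive.

(** The real line with the sigma-algebra on which [completed_lebesgue_measure]
    is defined. *)
Notation cleb R := (@caratheodory_type R (ocitv_type R) (@wlength R idfun)^*%mu).

(** * Reflection invariance of the completed Lebesgue measure *)

Lemma cleb_measurable_borel (R : realType) (A : set R) :
  measurable A -> measurable (A : set (cleb R)).
Proof. exact: sub_caratheodory. Qed.

(** Borel sets enlarged by parts of Borel null sets already form the completed sigma-algebra, so
    every member has this shape, with its null part covered by [N]. *)
Lemma cleb_decomp (R : realType) (A : set R) :
  measurable (A : set (cleb R)) ->
  exists B N, [/\ @measurable _ R B, @measurable _ R N,
    lebesgue_measure N = 0%E, B `<=` A & A `<=` B `|` N].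
Proof.
move=> mA; have : (completed_algebra_gen lebesgue_measure).-sigma.-measurable A.
  by rewrite completed_caratheodory_measurable.
rewrite g_sigma_completed_algebra_genE => -[B mB [N [F [mF F0 NF]] <-]].
by exists B, F; split => // z [|/NF]; [left|right].
Qed.

(** Converse of [cleb_decomp]: the difference of [A] and [B] lies in the null set [N]. *)
Lemma cleb_measurable_sandwich (R : realType) (A B N : set R) :
  @measurable _ R B -> @measurable _ R N -> lebesgue_measure N = 0%E ->
  B `<=` A -> A `<=` B `|` N -> measurable (A : set (cleb R)).
Proof.
move=> mB mN N0 BA ABN.
have := @completed_caratheodory_measurable R.
have -> : measurable = ((wlength idfun)^*%mu).-cara.-measurable :> set (set (cleb R)) by [].
move=> <-; rewrite g_sigma_completed_algebra_genE; exists B => //.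
exists (A `\` B).
  exists N; split => // z [/ABN[]]//.
by rewrite setDUK.
Qed.

Lemma measurable_reflect (R : realType) (c : R) (A : set R) :
  measurable A -> measurable ((fun s => c - s) @^-1` A).
Proof.
move=> mA; rewrite -[X in measurable X]setTI.
apply: (_ : measurable_fun setT (fun s : R => c - s)) => //.
by apply: measurable_funB.
Qed.

(** By uniqueness of Lebesgue measure it suffices to test the pushforward on half-open intervals:
    []a, b]] pulls back to [[c - b, c - a[], of the same length. *)
Lemma lebesgue_measure_reflect (R : realType) (c : R) (A : set R) : measurable A ->
  lebesgue_measure ((fun s => c - s) @^-1` A) = lebesgue_measure A.
Proof.
move=> mA.
have mf : measurable_fun [set: measurableTypeR R]
    ((fun s : R => c - s) : measurableTypeR R -> measurableTypeR R).
  by apply: measurable_funB.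
pose mf_mixin := isMeasurableFun.Build _ _ _ _ _ mf.
pose mf_pack := MeasurableFun.Pack (MeasurableFun.Class mf_mixin).
apply/esym.
apply: (lebesgue_measure_unique (mu := pushforward lebesgue_measure mf_pack)) => //=.
move=> _ [[a b] _ <-].
have -> : pushforward lebesgue_measure mf_pack `]a, b] = lebesgue_measure `[c - b, c - a[.
  congr lebesgue_measure; apply/seteqP; split => s /=; rewrite !in_itv/=; lra.
rewrite !lebesgue_measure_itv/= !lte_fin.
have -> : (c - b < c - a) = (a < b) by apply/idP/idP; lra.
by case: ifP => // _; congr EFin; lra.
Qed.

Lemma measurable_cleb_reflect (R : realType) (c : R) (A : set R) :
  measurable (A : set (cleb R)) -> measurable ((fun s => c - s) @^-1` A : set (cleb R)).
Proof.
move=> /cleb_decomp[B [N [mB mN N0 BA ABN]]].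
apply: (@cleb_measurable_sandwich _ _ ((fun s => c - s) @^-1` B)
  ((fun s => c - s) @^-1` N)).
- exact: measurable_reflect.
- exact: measurable_reflect.
- by rewrite -N0 lebesgue_measure_reflect.
- by move=> s; exact: BA.
- by move=> s; exact: ABN.
Qed.

(** Both measures come from one outer measure, so monotonicity and subadditivity bound the measure
    of [A] by that of [B] plus that of [N]. *)
Lemma completed_measure_sandwich (R : realType) (A B N : set R) :
  @measurable _ R B -> @measurable _ R N -> lebesgue_measure N = 0%E ->
  B `<=` A -> A `<=` B `|` N ->
  completed_lebesgue_measure (A : set (cleb R)) = @lebesgue_measure R B.
Proof.
move=> mB mN N0 BA ABN; apply/eqP; rewrite eq_le; apply/andP; split.
  apply: (@le_trans _ _ (lebesgue_measure (B `|` N))).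
    exact: le_outer_measure.
  by rewrite (le_trans (measureU2 _ _ _))//= N0 adde0.
exact: le_outer_measure.
Qed.

Lemma completed_measure_reflect (R : realType) (c : R) (A : set R) :
  measurable (A : set (cleb R)) ->
  completed_lebesgue_measure ((fun s => c - s) @^-1` A : set (cleb R)) =
  completed_lebesgue_measure (A : set (cleb R)).
Proof.
move=> /cleb_decomp[B [N [mB mN N0 BA ABN]]].
rewrite (@completed_measure_sandwich _ _ ((fun s => c - s) @^-1` B)
  ((fun s => c - s) @^-1` N)).
- by rewrite lebesgue_measure_reflect// (@completed_measure_sandwich _ A B N).
- exact: measurable_reflect.
- exact: measurable_reflect.
- by rewrite -N0 lebesgue_measure_reflect.
- by move=> s; exact: BA.
- by move=> s; exact: ABN.
Qed.

Local Open Scope ereal_scope.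

(** For nonnegative functions this is the pushforward formula, the measure being its own pushforward
    under the reflection; the general case splits into positive and negative parts. *)
Lemma completed_integral_reflect (R : realType) (c : R) (D : set (cleb R))
    (g : cleb R -> \bar R) :
  measurable D -> measurable_fun D g ->
  \int[completed_lebesgue_measure]_(s in D) g s =
  \int[completed_lebesgue_measure]_(s in (fun s => (c - s)%R) @^-1` D) g (c - s)%R.
Proof.
move=> mD mg.
have mr : measurable_fun [set: cleb R] ((fun s : R => (c - s)%R) : cleb R -> cleb R).
  by move=> _ B mB; rewrite setTI; exact: measurable_cleb_reflect.
pose r := MeasurableFun.Pack (MeasurableFun.Class (isMeasurableFun.Build _ _ _ _ _ mr)).
have E (h : cleb R -> \bar R) : measurable_fun D h -> (forall s, 0 <= h s) ->
    \int[completed_lebesgue_measure]_(s in D) h s =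
    \int[completed_lebesgue_measure]_(s in (fun s => (c - s)%R) @^-1` D) h (c - s)%R.
  move=> mh h0.
  transitivity (\int[pushforward completed_lebesgue_measure r]_(s in D) h s).
    by apply: eq_measure_integral => A mA _; apply/esym/completed_measure_reflect.
  by rewrite ge0_integral_pushforward.
rewrite integralE [RHS]integralE.
rewrite (E g^\+ (measurable_funepos mg) (funepos_ge0 g)).
rewrite (E g^\- (measurable_funeneg mg) (funeneg_ge0 g)).
congr (_ - _); apply: eq_integral => s _.
  by rewrite -[LHS]/((g^\+ \o (fun s : cleb R => (c - s)%R)) s) -funepos_comp.
by rewrite -[LHS]/((g^\- \o (fun s : cleb R => (c - s)%R)) s) -funeneg_comp.
Qed.

Local Close Scope ereal_scope.

(** * Convexity on a segment *)

Definition segment_convex (R : realFieldType) (a b : R) (f : R -> R) :=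
  forall u v k, a <= u <= b -> a <= v <= b -> 0 <= k <= 1 ->
  f (k * u + (1 - k) * v) <= k * f u + (1 - k) * f v.

(** Convexity with the denominator [w - u] cleared: this form survives [u = w] and can be fed to
    linear arithmetic. *)
Lemma segment_convex_chord (R : realFieldType) (a b : R) f u v w :
  segment_convex a b f -> a <= u -> u <= v -> v <= w -> w <= b ->
  (w - u) * f v <= (w - v) * f u + (v - u) * f w.
Proof.
move=> cf au uv vw wb.
have [uw|uw] := eqVneq u w.
  have -> : v = u by lra.
  by rewrite -uw; lra.
have wu : 0 < w - u by rewrite subr_gt0 lt_neqAle uw; lra.
have k01 : 0 <= (w - v) / (w - u) <= 1.
  by rewrite divr_ge0 ?ler_pdivrMr//=; lra.
have : f v <= (w - v) / (w - u) * f u + (1 - (w - v) / (w - u)) * f w.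
  have {1}-> : v = (w - v) / (w - u) * u + (1 - (w - v) / (w - u)) * w.
    by field; lra.
  by apply: cf => //; lra.
rewrite -(ler_pM2l wu) (_ : _ * (_ + _) = (w - v) * f u + (v - u) * f w)//.
by field; lra.
Qed.

(** Adding the chord inequalities at [s] and [t] gives the claim times [v - u]: since
    [s + t = u + v], the weights of [f u] sum to [v - u], and so do those of [f v]. *)
Lemma segment_convex_pair (R : realFieldType) (a b : R) f u v s t :
  segment_convex a b f -> a <= u -> v <= b ->
  u <= s <= v -> u <= t <= v -> s + t = u + v -> f s + f t <= f u + f v.
Proof.
move=> cf au vb us ut st.
have Hs : (v - u) * f s <= (v - s) * f u + (s - u) * f v.
  by apply: (segment_convex_chord cf); lra.
have Ht : (v - u) * f t <= (v - t) * f u + (t - u) * f v.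
  by apply: (segment_convex_chord cf); lra.
have [uv|uv] := eqVneq u v.
  have -> : s = u by lra.
  have -> : t = u by lra.
  by rewrite -uv.
have vu : 0 < v - u by rewrite subr_gt0 lt_neqAle uv; lra.
rewrite -(ler_pM2l vu).
have -> : t = u + v - s by lra.
move: Ht; have -> : t = u + v - s by lra.
nra.
Qed.

Lemma segment_convex_affine (R : realFieldType) (a b a' b' k m : R) f :
  segment_convex a b f -> (forall s, a' <= s <= b' -> a <= k * s + m <= b) ->
  segment_convex a' b' (fun s => f (k * s + m)).
Proof.
move=> cf ab u v l ua va l01.
rewrite (_ : k * _ + m = l * (k * u + m) + (1 - l) * (k * v + m)); last by ring.
by apply: cf => //; exact: ab.
Qed.

Lemma segment_convexD (R : realFieldType) (a b : R) f g :
  segment_convex a b f -> segment_convex a b g ->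
  segment_convex a b (fun s => f s + g s).
Proof.
move=> cf cg u v k ua va k01.
by have := cf u v k ua va k01; have := cg u v k ua va k01; lra.
Qed.

(** * The even function [phi]: monotonicity, majorization and Lipschitz estimates *)

Definition sym_sum (R : realFieldType) (f : R -> R) (c r : R) := f (c + r) + f (c - r).

Section sym_sum.
Variables (R : realFieldType) (f : R -> R) (c X : R).
Hypothesis cf : segment_convex (c - X) (c + X) f.
Local Notation phi := (sym_sum f c).

Lemma sym_sumN r : phi (- r) = phi r.
Proof. by rewrite /sym_sum opprK addrC. Qed.

Lemma sym_sum_norm r : phi `|r| = phi r.
Proof. by case: ger0P => _; rewrite ?sym_sumN. Qed.

Lemma sym_sum_convex : segment_convex (- X) X phi.
Proof.
apply: segment_convexD.
  rewrite (_ : (fun s => f (c + s)) = fun s => f (1 * s + c)); last first.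
    by apply/funext => s; rewrite mul1r addrC.
  apply: (segment_convex_affine cf) => s. lra.
rewrite (_ : (fun s => f (c - s)) = fun s => f (-1 * s + c)); last first.
  by apply/funext => s; rewrite mulN1r addrC.
by apply: (segment_convex_affine cf) => s; lra.
Qed.

(** The points [q] and [- q] lie between [- r] and [r] and have the same sum, so
    [segment_convex_pair] and evenness give twice the inequality. *)
Lemma sym_sum_le q r : `|q| <= r -> r <= X -> phi q <= phi r.
Proof.
rewrite ler_norml => qr rX.
have := segment_convex_pair (u := - r) (v := r) (s := q) (t := - q) sym_sum_convex.
by rewrite !sym_sumN; lra.
Qed.

Lemma sym_sum_pair q r s t : - X <= q -> r <= X -> q <= s <= r -> q <= t <= r ->
  s + t = q + r -> phi s + phi t <= phi q + phi r.
Proof. exact: (segment_convex_pair sym_sum_convex). Qed.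

(** If |D| <= |B|, monotonicity works term by term. Otherwise [C] and |D| lie between |B| and C +
    |D| - |B|, a pair with the same sum whose larger member is at most [A]. *)
Lemma sym_sum_weak_maj A B C D : A <= X -> `|B| <= X -> C <= A -> `|D| <= C ->
  C + `|D| <= A + `|B| -> phi C + phi D <= phi A + phi B.
Proof.
move=> AX BX CA DC CDAB; have D0 := normr_ge0 D; have B0 := normr_ge0 B.
have [DB|BD] := lerP `|D| `|B|.
  by rewrite -(sym_sum_norm B) lerD// sym_sum_le// ger0_norm//; lra.
have H := @sym_sum_pair `|B| (C + `|D| - `|B|) C `|D|.
have AE : phi (C + `|D| - `|B|) <= phi A.
  by rewrite sym_sum_le// ger0_norm; lra.
by move: H; rewrite !sym_sum_norm; lra.
Qed.

(** For u, v >= 0 one has |u + v| + |u - v| = 2 max(u, v), so the weak majorization amounts to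
    max(tS, (1-t)Y) <= max(tX, (1-t)S). *)
Lemma sym_sum_spread S Y t : 0 <= Y -> Y <= S -> S <= X -> 0 <= t <= 1 ->
  phi (t * S + (1 - t) * Y) + phi (t * S - (1 - t) * Y)
    <= phi (t * X + (1 - t) * S) + phi (t * X - (1 - t) * S).
Proof.
move=> Y0 YS SX /andP[t0 t1].
(* Linear arithmetic treats products with [t] as atoms, so their signs are supplied beforehand. *)
have p1 : 0 <= t * (X - S) by apply: mulr_ge0; lra.
have p2 : 0 <= (1 - t) * (X - S) by apply: mulr_ge0; lra.
have p3 : 0 <= t * (S - Y) by apply: mulr_ge0; lra.
have p4 : 0 <= (1 - t) * (S - Y) by apply: mulr_ge0; lra.
have p5 : 0 <= t * Y by apply: mulr_ge0; lra.
have p6 : 0 <= (1 - t) * Y by apply: mulr_ge0; lra.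
apply: sym_sum_weak_maj; rewrite ?ler_norml; try lra.
have := ler_norm (t * X - (1 - t) * S); have := ler_norm (- (t * X - (1 - t) * S)).
by rewrite normrN; case: (ger0P (t * S - (1 - t) * Y)); lra.
Qed.

Variables K0 K1 : R.
Hypothesis X0 : 0 < X.
Hypothesis slopef : forall u v, c - X <= u -> u <= v -> v <= c + X ->
  K0 * (v - u) <= f v - f u <= K1 * (v - u).

(** The term f(c + .) grows with slope at most [K1], the term f(c - .) with slope at most [- K0]. In
    the end [K0] and [K1] are the derivatives at [x] and [x']. *)
Lemma sym_sum_lip q r : - X <= q -> q <= r -> r <= X ->
  phi r - phi q <= (K1 - K0) * (r - q).
Proof.
move=> Xq qr rX; rewrite /sym_sum.
have := @slopef (c + q) (c + r); have := @slopef (c - r) (c - q).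
rewrite (_ : c - q - (c - r) = r - q); last by ring.
rewrite (_ : c + r - (c + q) = r - q); last by ring.
by lra.
Qed.

Lemma slopes_le : 0 <= K1 - K0.
Proof.
move: X0 => X0'.
have /andP[h1 h2] : K0 * (2 * X) <= f (c + X) - f (c - X) <= K1 * (2 * X).
  by rewrite (_ : 2 * X = c + X - (c - X)); [apply: slopef; lra|ring].
by have := le_trans h1 h2; rewrite ler_pM2r; lra.
Qed.

(** The terms with a plus sign have arguments t(X - S) + (1-t)(S - Y) <= X - Y apart. The difference
    of the terms with a minus sign is at most phi |B| - phi 0, with |B| <= X. Together the distances
    make [2 * X - Y]. *)
Lemma sym_sum_spread_lip S Y t : 0 <= Y -> Y <= S -> S <= X -> 0 <= t <= 1 ->
  phi (t * X + (1 - t) * S) + phi (t * X - (1 - t) * S)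
    - (phi (t * S + (1 - t) * Y) + phi (t * S - (1 - t) * Y))
    <= (K1 - K0) * (2 * X - Y).
Proof.
move=> Y0 YS SX /andP[t0 t1].
have K0K := slopes_le.
have p1 : 0 <= t * (X - S) by apply: mulr_ge0; lra.
have p2 : 0 <= (1 - t) * (X - S) by apply: mulr_ge0; lra.
have p3 : 0 <= t * (S - Y) by apply: mulr_ge0; lra.
have p4 : 0 <= (1 - t) * (S - Y) by apply: mulr_ge0; lra.
have p5 : 0 <= t * Y by apply: mulr_ge0; lra.
have p6 : 0 <= (1 - t) * Y by apply: mulr_ge0; lra.
set B := t * X - (1 - t) * S.
have Bn := normr_ge0 B.
have BX : `|B| <= X by rewrite ler_norml /B; lra.
have AC := @sym_sum_lip (t * S + (1 - t) * Y) (t * X + (1 - t) * S).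
have B0 := @sym_sum_lip 0 `|B|.
have D0 : phi 0 <= phi (t * S - (1 - t) * Y).
  by rewrite -[leRHS]sym_sum_norm sym_sum_le ?normr0// ler_norml; lra.
have H3 : 0 <= (K1 - K0) * ((X - Y) - (t * (X - S) + (1 - t) * (S - Y))).
  by apply: mulr_ge0; lra.
have H4 : 0 <= (K1 - K0) * (X - `|B|) by apply: mulr_ge0; lra.
by move: B0; rewrite sym_sum_norm; lra.
Qed.

Lemma sym_sum_cross_lip S t : 0 <= S -> S <= X -> 0 <= t <= 1 ->
  phi (t * X + (1 - t) * S) - phi (t * X - (1 - t) * S) <= (K1 - K0) * X.
Proof.
move=> S0 SX /andP[t0 t1].
have K0K := slopes_le.
have p1 : 0 <= t * (X - S) by apply: mulr_ge0; lra.
have p2 : 0 <= (1 - t) * (X - S) by apply: mulr_ge0; lra.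
have p3 : 0 <= t * S by apply: mulr_ge0; lra.
have p4 : 0 <= (1 - t) * S by apply: mulr_ge0; lra.
set A := t * X + _; set B := _ - _ * S.
have Bn := normr_ge0 B.
have BA : `|B| <= A by rewrite ler_norml /A /B; lra.
have AX : A <= X by rewrite /A; lra.
have BAX : A - `|B| <= X.
  have := ler_norm B; have := ler_norm (- B); rewrite normrN /A /B.
  (* A - |B| is at most A + B = 2tX, which suffices for t <= 1/2, and at most A - B = 2(1-t)S, which
     suffices for t > 1/2. *)
  have [t2|t2] := lerP t 2^-1.
    have : 0 <= (1 - 2 * t) * X by apply: mulr_ge0; lra.
    by lra.
  have : 0 <= (2 * t - 1) * S by apply: mulr_ge0; lra.
  by lra.
have H3 : 0 <= (K1 - K0) * (X - (A - `|B|)) by apply: mulr_ge0; lra.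
by have := @sym_sum_lip `|B| A; rewrite sym_sum_norm; lra.
Qed.
End sym_sum.

(** * One-sided derivatives as bounds for slopes *)

Lemma cvg_within_at_right (R : realType) (x y : R) (E : set R) (g : R -> R) :
  x < y -> `[x, y] `<=` E -> cvg (g s @[s --> within E x^']) ->
  g s @[s --> x^'+] --> lim (g s @[s --> within E x^']).
Proof.
(* Points just to the right of [x] lie in [x, y], hence in [E], and differ from [x]; so the
   right-hand filter refines the punctured filter within [E]. *)
move=> xy xyE; apply: cvg_trans; apply: cvg_app => P.
move=> /= EP; near=> w.
have xw : x < w by [].
have wy : w < y by near: w; exact: nbhs_right_lt.
have /= EPw : w != x -> E w -> P w.
  near: w.
  exact: (@filterS _ (nbhs x) _ _ _ (fun z H _ => H) EP).
apply: EPw; first by rewrite gt_eqF.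
by apply: xyE; rewrite /= in_itv/= !ltW.
Unshelve. all: by end_near. Qed.

Lemma cvg_within_at_left (R : realType) (x y : R) (E : set R) (g : R -> R) :
  y < x -> `[y, x] `<=` E -> cvg (g s @[s --> within E x^']) ->
  g s @[s --> x^'-] --> lim (g s @[s --> within E x^']).
Proof.
move=> xy xyE; apply: cvg_trans; apply: cvg_app => P.
move=> /= EP; near=> w.
have xw : w < x by [].
have wy : y < w by near: w; exact: nbhs_left_gt.
have /= EPw : w != x -> E w -> P w.
  near: w.
  exact: (@filterS _ (nbhs x) _ _ _ (fun z H _ => H) EP).
apply: EPw; first by rewrite lt_eqF.
by apply: xyE; rewrite /= in_itv/= !ltW.
Unshelve. all: by end_near. Qed.

(** Chord slopes from [x] are nondecreasing in the other end point, so their limit at [x] is below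
    all of them; and the slope over [u, v] is at least that over [x, u]. *)
Lemma slope_ge_right_deriv (R : realType) (x y x' : R) (E : set R) (f : R -> R) :
  x < y -> y <= x' ->
  `[x, y] `<=` E -> segment_convex x x' f ->
  cvg ((f s - f x) / (s - x) @[s --> within E x^']) ->
  forall u v, x <= u -> u <= v -> v <= x' ->
  deriv_on E f x * (v - u) <= f v - f u.
Proof.
move=> xy yx' xyE cf cv.
have sl s : x < s -> s <= x' -> deriv_on E f x <= (f s - f x) / (s - x).
  move=> xs sx'; have cvr := cvg_within_at_right xy xyE cv.
  rewrite /deriv_on -(cvg_lim _ cvr)//; apply: limr_le.
    by apply/cvg_ex; eexists; exact: cvr.
  near=> w.
  have xw : x < w by [].
  have ws : w < s by near: w; exact: nbhs_right_lt.
  rewrite ler_pdivlMr ?subr_gt0// mulrAC ler_pdivrMr ?subr_gt0//.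
  have : (s - x) * f w <= (s - w) * f x + (w - x) * f s.
    by apply: (segment_convex_chord cf); lra.
  by lra.
move=> u v xu uv vx'.
have [->|xu'] := eqVneq u x.
  have [->|xv] := eqVneq v x; first by rewrite !subrr mulr0.
  have vx : 0 < v - x by rewrite subr_gt0 lt_neqAle eq_sym xv; lra.
  by rewrite -ler_pdivlMr// sl//; lra.
have ux : 0 < u - x by rewrite subr_gt0 lt_neqAle eq_sym xu'; lra.
have H : (v - x) * f u <= (v - u) * f x + (u - x) * f v.
  by apply: (segment_convex_chord cf); lra.
have H2 : deriv_on E f x * (u - x) <= f u - f x.
  by rewrite -ler_pdivlMr// sl//; lra.
rewrite -(ler_pM2l ux).
have H3 : 0 <= (f u - f x - deriv_on E f x * (u - x)) * (v - u).
  by rewrite mulr_ge0; lra.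
by lra.
Unshelve. all: by end_near. Qed.

(** Mirror image of [slope_ge_right_deriv]: chord slopes into [x'] increase to the derivative, and
    the slope over [u, v] is at most that over [v, x']. *)
Lemma slope_le_left_deriv (R : realType) (x y x' : R) (E : set R) (f : R -> R) :
  x <= y -> y < x' ->
  `[y, x'] `<=` E -> segment_convex x x' f ->
  cvg ((f s - f x') / (s - x') @[s --> within E x'^']) ->
  forall u v, x <= u -> u <= v -> v <= x' ->
  f v - f u <= deriv_on E f x' * (v - u).
Proof.
move=> xy yx' xyE cf cv.
have sl s : x <= s -> s < x' -> (f s - f x') / (s - x') <= deriv_on E f x'.
  move=> xs sx'; have cvr := cvg_within_at_left yx' xyE cv.
  rewrite /deriv_on -(cvg_lim _ cvr)//; apply: limr_ge.
    by apply/cvg_ex; eexists; exact: cvr.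
  near=> w.
  have wx : w < x' by [].
  have sw : s < w by near: w; exact: nbhs_left_gt.
  rewrite -mulrNN -invrN -[leRHS]mulrNN -invrN !opprB.
  rewrite ler_pdivlMr ?subr_gt0// mulrAC ler_pdivrMr ?subr_gt0//.
  have : (x' - s) * f w <= (x' - w) * f s + (w - s) * f x'.
    by apply: (segment_convex_chord cf); lra.
  by lra.
have sl' s : x <= s -> s < x' -> f x' - f s <= deriv_on E f x' * (x' - s).
  move=> xs sx'; rewrite -ler_pdivrMr ?subr_gt0//.
  by rewrite -mulrNN -invrN !opprB sl.
move=> u v xu uv vx'.
have [->|vx] := eqVneq v x'.
  have [->|ux] := eqVneq u x'; first by rewrite !subrr mulr0.
  by rewrite sl'// lt_neqAle ux; lra.
have vx0 : 0 < x' - v by rewrite subr_gt0 lt_neqAle vx.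
have H : (x' - u) * f v <= (x' - v) * f u + (v - u) * f x'.
  by apply: (segment_convex_chord cf); lra.
have H2 : f x' - f v <= deriv_on E f x' * (x' - v) by apply: sl'; lra.
rewrite -(ler_pM2l vx0).
have H3 : 0 <= (deriv_on E f x' * (x' - v) - (f x' - f v)) * (v - u).
  by rewrite mulr_ge0; lra.
by lra.
Unshelve. all: by end_near. Qed.

(** * Integrals against a weight *)

Section weighted_integral.
Context {R : realType}.
Implicit Types (D : set R) (f g h p : R -> R) (a b e : R).

Lemma lintegrable_reflect e D g : measurable (D : set (cleb R)) ->
  lintegrable D g ->
  lintegrable ((fun s => e - s) @^-1` D) (fun s => g (e - s)).
Proof.
move=> mD /integrableP[mg goo]; apply/integrableP; split.
  move=> mrD B mB; have := measurable_cleb_reflect e (mg mD B mB).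
  by rewrite preimage_setI.
have mag := measurableT_comp (@abse_measurable R setT) mg.
by rewrite -(completed_integral_reflect e mD mag).
Qed.

Lemma lint_reflect e D g : measurable (D : set (cleb R)) -> lintegrable D g ->
  lint D g = lint ((fun s => e - s) @^-1` D) (fun s => g (e - s)).
Proof.
by move=> mD /integrableP[mg _]; rewrite /lint /Rintegral (completed_integral_reflect e).
Qed.

Lemma reflect_itvcc e a b : (fun s => e - s) @^-1` `[a, b] = `[e - b, e - a]%classic.
Proof. by apply/seteqP; split => s; rewrite /= !in_itv/=; lra. Qed.

Lemma measurable_cleb_itv (i : interval R) : measurable ([set` i] : set (cleb R)).
Proof. exact: cleb_measurable_borel. Qed.

Lemma lintegrable_reflect_itv e a b a' b' g : a' = e - b -> b' = e - a ->
  lintegrable `[a, b] g -> lintegrable `[a', b'] (fun s => g (e - s)).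
Proof.
move=> -> -> /(lintegrable_reflect e (measurable_cleb_itv _)).
by rewrite reflect_itvcc.
Qed.

Lemma lint_reflect_itv e a b a' b' g : a' = e - b -> b' = e - a ->
  lintegrable `[a, b] g -> lint `[a, b] g = lint `[a', b'] (fun s => g (e - s)).
Proof.
move=> -> -> ig; rewrite (lint_reflect e _ ig) ?reflect_itvcc//.
exact: measurable_cleb_itv.
Qed.

Lemma lintD D g h : measurable (D : set (cleb R)) ->
  lintegrable D g -> lintegrable D h ->
  lint D (fun s => g s + h s) = lint D g + lint D h.
Proof. by move=> mD ig ih; rewrite /lint RintegralD. Qed.

Lemma lintZ D g k : measurable (D : set (cleb R)) -> lintegrable D g ->
  lint D (fun s => k * g s) = k * lint D g.
Proof. by move=> mD ig; rewrite /lint RintegralZl. Qed.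

Lemma lintegrableD D g h : measurable (D : set (cleb R)) ->
  lintegrable D g -> lintegrable D h ->
  lintegrable D (fun s => g s + h s).
Proof.
move=> mD ig ih; rewrite /lintegrable.
rewrite (_ : EFin \o _ = (EFin \o g) \+ (EFin \o h))%E; last by apply/funext.
exact: integrableD.
Qed.

Lemma lintegrableZ D g k : measurable (D : set (cleb R)) -> lintegrable D g ->
  lintegrable D (fun s => k * g s).
Proof.
move=> mD ig; rewrite /lintegrable.
rewrite (_ : EFin \o _ = (fun s => k%:E * (EFin \o g) s)%E); last by apply/funext.
exact: integrableZl.
Qed.

Lemma lintegrableS D D' g : measurable (D : set (cleb R)) -> measurable (D' : set (cleb R)) ->
  D' `<=` D -> lintegrable D g -> lintegrable D' g.
Proof. by move=> mD mD' D'D; apply: integrableS. Qed.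

Lemma eq_lint D g h : (forall s, D s -> g s = h s) -> lint D g = lint D h.
Proof. by move=> gh; apply: eq_Rintegral => s; rewrite inE; exact: gh. Qed.

Lemma eq_lintegrable D g h : measurable (D : set (cleb R)) ->
 (forall s, D s -> g s = h s) -> lintegrable D g -> lintegrable D h.
Proof.
by move=> mD gh; apply: eq_integrable => // s; rewrite inE => Ds /=; rewrite gh.
Qed.

Lemma measurable_cleb_set1 a : measurable ([set a] : set (cleb R)).
Proof. by apply: cleb_measurable_borel; exact: measurable_set1. Qed.

Lemma lint_setD1 D g a : measurable (D : set (cleb R)) -> lintegrable D g ->
  lint D g = lint (D `\ a) g.
Proof.
move=> mD ig; congr fine; apply: negligible_integral => //.
  exact: measurable_cleb_set1.
exact: (lebesgue_measure_set1 a).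
Qed.

(** A convex function may jump at the ends of the segment, so continuity is no basis here; but its
    strict sublevel sets are intervals, hence Borel. *)
Lemma segment_convex_measurable a b h : segment_convex a b h ->
  @measurable_fun _ _ (cleb R) R `[a, b] h.
Proof.
move=> ch; apply: (@measurability _ _ (cleb R) R `[a, b]%classic h (@RGenInftyO.G R)).
  exact: RGenInftyO.measurableE.
move=> _ [_ [M ->] <-]; apply: cleb_measurable_borel; apply: is_interval_measurable.
move=> s t; rewrite /= !in_itv/= => -[sI hs] [tI ht] w /andP[sw wt].
rewrite /= !in_itv/=; split; first lra.
have [st|st] := eqVneq s t; first by have -> : w = s by lra.
have ts : 0 < t - s by rewrite subr_gt0 lt_neqAle st; lra.
have : (t - s) * h w <= (t - w) * h s + (w - s) * h t.
  by apply: (segment_convex_chord ch); lra.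
rewrite -(ltr_pM2l ts) => /le_lt_trans; apply.
have H1 : 0 <= (t - w) * (M - h s) by apply: mulr_ge0; lra.
have H2 : 0 <= (w - s) * (M - h t) by apply: mulr_ge0; lra.
(* One weight is positive, [t - w] if [w = s] and [w - s] otherwise, which makes the inequality
   strict. *)
have [sw'|sw'] := eqVneq s w.
  have : 0 < (t - w) * (M - h s) by rewrite mulr_gt0; lra.
  by lra.
have : 0 < (w - s) * (M - h t).
  by rewrite mulr_gt0// subr_gt0// lt_neqAle sw'.
by lra.
Qed.

(** Chords bound [h] above by [M]; with m the midpoint, h(s) >= 2h(m) - h(a + b - s) >= 2h(m) - M
    bounds it below. *)
Lemma segment_convex_bounded a b h : segment_convex a b h ->
  exists M, forall s, a <= s <= b -> `|h s| <= M.
Proof.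
move=> ch; pose M := `|h a| + `|h b|; exists (M + 2 * `|h ((a + b) / 2)|).
move=> s asb.
have up t : a <= t <= b -> h t <= M.
  move=> atb.
  have [ab|ab] := eqVneq a b.
    by have -> : t = a by [lra]; rewrite /M;
      have := ler_norm (h a); have := normr_ge0 (h b); lra.
  have ba : 0 < b - a by rewrite subr_gt0 lt_neqAle ab; lra.
  rewrite -(ler_pM2l ba).
  have : (b - a) * h t <= (b - t) * h a + (t - a) * h b.
    by apply: (segment_convex_chord ch); lra.
  move=> /le_trans; apply.
  have Ha := ler_norm (h a); have Hb := ler_norm (h b).
  have : 0 <= (b - t) * (`|h a| - h a) by apply: mulr_ge0; lra.
  have : 0 <= (t - a) * (`|h b| - h b) by apply: mulr_ge0; lra.
  have : 0 <= (t - a) * `|h a| by apply: mulr_ge0 => //; lra.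
  have : 0 <= (b - t) * `|h b| by apply: mulr_ge0 => //; lra.
  by rewrite /M; lra.
have ms := up s asb.
have mr : h (a + b - s) <= M by apply: up; lra.
have mid : 2 * h ((a + b) / 2) <= h s + h (a + b - s).
  have H : h (2^-1 * s + (1 - 2^-1) * (a + b - s)) <= 2^-1 * h s + (1 - 2^-1) * h (a + b - s).
    by apply: ch; lra.
  move: H; have -> : 2^-1 * s + (1 - 2^-1) * (a + b - s) = (a + b) / 2 by field.
  by lra.
have := ler_norm (h ((a + b) / 2)); have := ler_norm (- h ((a + b) / 2)).
by rewrite normrN ler_norml; lra.
Qed.

Lemma lintegrable_convexM a b h p : segment_convex a b h ->
  lintegrable `[a, b] p -> lintegrable `[a, b] (fun s => h s * p s).
Proof.
move=> ch ip.
rewrite /lintegrable (_ : EFin \o _ = (EFin \o h) \* (EFin \o p))%E; last by apply/funext.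
apply: integrableMr ip; first exact: measurable_cleb_itv.
  exact: segment_convex_measurable.
have [M hM] := segment_convex_bounded ch.
exists M; split; first exact: num_real.
by move=> N MN s /= sI; rewrite (le_trans (hM s _)) ?(ltW MN)// -(itv_boundlr _ _ s).
Qed.

(** The intervals may share the point [b = a'], as [x, y] and [y', x'] do for alpha = 1/2; this null
    point is removed to make the pieces disjoint. *)
Lemma lint_itvU a b a' b' g : b <= a' ->
  lintegrable (`[a, b] `|` `[a', b']) g ->
  lint (`[a, b] `|` `[a', b']) g = lint `[a, b] g + lint `[a', b'] g.
Proof.
move=> ba' ig; have mU c d := @measurable_cleb_itv `[c, d].
have mD1 c d : measurable (`[c, d] `\ a' : set (cleb R)).
  by apply: measurableD => //; exact: measurable_cleb_set1.
have mUU : measurable (`[a, b] `|` `[a', b'] : set (cleb R)) by exact: measurableU.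
have i1 : lintegrable `[a, b] g by apply: lintegrableS ig.
have i2 : lintegrable `[a', b'] g by apply: lintegrableS ig.
rewrite (lint_setD1 a' _ ig)// (lint_setD1 a' _ i1)// (lint_setD1 a' _ i2)//.
rewrite setDUl /lint Rintegral_setU//.
- by rewrite -setDUl; apply: lintegrableS ig => //; rewrite setDUl; exact: measurableU.
- apply/disj_setPRL => s /=; rewrite !in_itv/=; lra.
Qed.

Lemma le_lint_affine D h g p C : measurable (D : set (cleb R)) ->
  lintegrable D p -> (forall s, D s -> 0 <= p s) ->
  lintegrable D (fun s => h s * p s) -> lintegrable D (fun s => g s * p s) ->
  (forall s, D s -> h s <= g s + C) ->
  lint D (fun s => h s * p s) <= lint D (fun s => g s * p s) + C * lint D p.
Proof.
move=> mD ip p0 ih ig hg; rewrite -lintZ// -lintD//; last exact: lintegrableZ.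
apply: le_Rintegral => //; first by apply: lintegrableD => //; exact: lintegrableZ.
by move=> s Ds; rewrite -mulrDl ler_wpM2r ?p0 ?hg.
Qed.

Lemma lint_sym a b p h : (symmetric_weight a b p) ->
  lintegrable `[a, b] (fun s => h s * p s) ->
  lint `[a, b] (fun s => h s * p s) = lint `[a, b] (fun s => h (a + b - s) * p s).
Proof.
move=> ps ih.
have aE : a = a + b - b by ring.
have bE : b = a + b - a by ring.
rewrite (lint_reflect_itv aE bE ih).
by apply: eq_lint => s sI; rewrite -ps.
Qed.

(** Since [p] is symmetric, an integrand plus its reflection integrates to twice the original
    integral; hence the pointwise hypothesis on symmetrized integrands and the constant [2 * C]. *)
Lemma le_lint_sym a b h g p C :
  lintegrable `[a, b] p -> (forall s, s \in `[a, b] -> 0 <= p s) -> symmetric_weight a b p ->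
  lintegrable `[a, b] (fun s => h s * p s) -> lintegrable `[a, b] (fun s => g s * p s) ->
  (forall s, a <= s <= b -> h s + h (a + b - s) <= g s + g (a + b - s) + 2 * C) ->
  lint `[a, b] (fun s => h s * p s) <= lint `[a, b] (fun s => g s * p s) + C * lint `[a, b] p.
Proof.
move=> ip p0 ps ih ig hg; have mI := @measurable_cleb_itv `[a, b].
have ir k : lintegrable `[a, b] (fun s => k s * p s) ->
    lintegrable `[a, b] (fun s => k (a + b - s) * p s).
  have aE : a = a + b - b by ring.
  have bE : b = a + b - a by ring.
  move=> /(lintegrable_reflect_itv aE bE).
  by apply: eq_lintegrable => // s sI; rewrite -ps.
have H : lint `[a, b] (fun s => (h s + h (a + b - s)) * p s) <=
    lint `[a, b] (fun s => (g s + g (a + b - s)) * p s) + (2 * C) * lint `[a, b] p.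
  apply: le_lint_affine => //.
  - apply: (@eq_lintegrable _ (fun s => h s * p s + h (a + b - s) * p s)) => //.
      by move=> s _; rewrite mulrDl.
    exact/lintegrableD/ir.
  - apply: (@eq_lintegrable _ (fun s => g s * p s + g (a + b - s) * p s)) => //.
      by move=> s _; rewrite mulrDl.
    exact/lintegrableD/ir.
have dbl k : lintegrable `[a, b] (fun s => k s * p s) ->
    lint `[a, b] (fun s => (k s + k (a + b - s)) * p s) =
    2 * lint `[a, b] (fun s => k s * p s).
  move=> ik; under eq_lint do rewrite mulrDl.
  rewrite lintD//; last exact: ir.
  by rewrite -lint_sym//; ring.
by move: H; rewrite !dbl//; lra.
Qed.

End weighted_integral.

(** * Affine substitutions in convex functions *)

Lemma segment_convex_comp (R : realFieldType) (a b a' b' : R) (f A : R -> R) :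
  segment_convex a b f -> (forall s, A s = (A 1 - A 0) * s + A 0) ->
  (forall s, a' <= s <= b' -> a <= A s <= b) ->
  segment_convex a' b' (fun s => f (A s)).
Proof.
(* The coefficients of [A] are read off at 0 and 1, so that checking affinity is a ring identity. *)
move=> cf AE Aab; rewrite (_ : (fun s => _) = (fun s => f ((A 1 - A 0) * s + A 0))).
  by apply: (segment_convex_affine cf) => s; rewrite -AE; exact: Aab.
by apply/funext => s; rewrite -AE.
Qed.

Lemma segment_convexZ (R : realFieldType) (a b k : R) f : 0 <= k ->
  segment_convex a b f -> segment_convex a b (fun s => k * f s).
Proof.
move=> k0 cf u v l ua va l01.
by have := ler_wpM2l k0 (cf u v l ua va l01); lra.
Qed.

Lemma mix_itv (R : realFieldType) (X a b t : R) : 0 <= t <= 1 ->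
  - X <= a <= X -> - X <= b <= X -> - X <= t * a + (1 - t) * b <= X.
Proof.
move=> /andP[t0 t1] aX bX.
have p1 : 0 <= t * (X - a) by apply: mulr_ge0; lra.
have p2 : 0 <= t * (X + a) by apply: mulr_ge0; lra.
have p3 : 0 <= (1 - t) * (X - b) by apply: mulr_ge0; lra.
have p4 : 0 <= (1 - t) * (X + b) by apply: mulr_ge0; lra.
by lra.
Qed.

(** * The inequalities in coordinates centred at [c] *)

Section weighted_inequalities.
Variables (R : realType) (f p : R -> R) (c X Y alpha : R).
Hypotheses (X0 : 0 < X) (alpha0 : 0 < alpha) (alpha2 : alpha <= 2^-1).
Hypothesis YE : Y = (1 - 2 * alpha) * X.
Local Notation x := (c - X).
Local Notation x' := (c + X).
Local Notation y := (c - Y).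
Local Notation y' := (c + Y).
Local Notation r s := (x + x' - s).
Local Notation phi := (sym_sum f c).
Hypothesis cf : segment_convex x x' f.
Hypothesis p0 : forall s, s \in `[x, x'] -> 0 <= p s.
Hypothesis ip : lintegrable `[x, x'] p.
Hypothesis ps : symmetric_weight x x' p.

(** [(1 - alpha) * x + alpha * s = c - U s] and
    [(1 - alpha) * x' + alpha * s = c + U (r s)]: in these terms [N], [I1], [I2]
    and [S] are the integrands of Np, Ip1, Ip2 and Sp. *)
Let U s := (1 - alpha) * X - alpha * (s - c).

Let Y0 : 0 <= Y.
Proof. by move: X0 alpha2 => ? ?; rewrite YE mulr_ge0//; lra. Qed.

Let YX : Y <= X.
Proof.
move: X0 alpha0 => ? ?; have : 0 <= alpha * X by apply: mulr_ge0; lra.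
by rewrite YE; lra.
Qed.

Let Ubound s : x <= s <= x' -> Y <= U s <= X.
Proof.
move: alpha0 => a0 sx; have a0' : 0 <= alpha by lra.
have p1 : 0 <= alpha * (s - x) by apply: mulr_ge0; lra.
have p2 : 0 <= alpha * (x' - s) by apply: mulr_ge0; lra.
by rewrite /U YE; lra.
Qed.

(** [U] decreases from [X] to [Y] on [x, x'], so reflection in [c] becomes reflection in the
    midpoint of [Y, X]. *)
Let Ur s : U s + U (r s) = X + Y.
Proof. by rewrite /U YE; ring. Qed.

Let rr s : r (r s) = s.
Proof. by ring. Qed.

Let rI s : x <= s <= x' -> x <= r s <= x'.
Proof. by lra. Qed.

Let N t s := f (c - (t * X + (1 - t) * U s)) + f (c + (t * X + (1 - t) * U (r s))).
Let I1 t s := f (c - (t * U s + (1 - t) * Y)) + f (c + (t * U (r s) + (1 - t) * Y)).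
Let I2 t s := f (c - (t * U s - (1 - t) * Y)) + f (c + (t * U (r s) - (1 - t) * Y)).
(** The two mixed terms of Sp, where an end point meets the combination attached to the opposite
    end. *)
Let M t s := f (c - (t * X - (1 - t) * U (r s))) + f (c + (t * X - (1 - t) * U s)).
Let S t s := 2^-1 * (N t s + M t s).

Let NpE t : Np f p alpha x x' t = lint `[x, x'] (fun s => N t s * p s).
Proof.
rewrite /Np; congr lint; apply/funext => s; congr ((f _ + f _) * _); rewrite /U; ring.
Qed.

Let Ip1E t : Ip1 f p alpha x x' y y' t = lint `[x, x'] (fun s => I1 t s * p s).
Proof.
rewrite /Ip1; congr lint; apply/funext => s; congr ((f _ + f _) * _); rewrite /U; ring.
Qed.

Let Ip2E t : Ip2 f p alpha x x' y y' t = lint `[x, x'] (fun s => I2 t s * p s).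
Proof.
rewrite /Ip2; congr lint; apply/funext => s; congr ((f _ + f _) * _); rewrite /U; ring.
Qed.

Let SpE t : Sp f p alpha x x' t = lint `[x, x'] (fun s => S t s * p s).
Proof.
rewrite /Sp; congr lint; apply/funext => s; congr (_ * _ * _).
(* Regroup: the first and last of the four terms form [N], the middle two form [M]. *)
rewrite -2!addrA [X in _ + X]addrA [X in _ + X]addrC addrA.
by rewrite /N /M; congr (f _ + f _ + (f _ + f _)); rewrite /U; ring.
Qed.

Let mixN t s : 0 <= t <= 1 -> x <= s <= x' ->
  x <= c - (t * X + (1 - t) * U s) <= x' /\ x <= c + (t * X + (1 - t) * U s) <= x'.
Proof.
move=> t01 /Ubound Us; move: X0 Y0 YX => ? ? ?.
by have := @mix_itv _ X X (U s) t t01; lra.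
Qed.

Let mixM t s : 0 <= t <= 1 -> x <= s <= x' ->
  x <= c - (t * X - (1 - t) * U s) <= x' /\ x <= c + (t * X - (1 - t) * U s) <= x'.
Proof.
move=> t01 /Ubound Us; move: X0 Y0 YX => ? ? ?.
by have := @mix_itv _ X X (- U s) t t01; lra.
Qed.

Let mixI1 t s : 0 <= t <= 1 -> x <= s <= x' ->
  x <= c - (t * U s + (1 - t) * Y) <= x' /\ x <= c + (t * U s + (1 - t) * Y) <= x'.
Proof.
move=> t01 /Ubound Us; move: X0 Y0 YX => ? ? ?.
by have := @mix_itv _ X (U s) Y t t01; lra.
Qed.

Let mixI2 t s : 0 <= t <= 1 -> x <= s <= x' ->
  x <= c - (t * U s - (1 - t) * Y) <= x' /\ x <= c + (t * U s - (1 - t) * Y) <= x'.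
Proof.
move=> t01 /Ubound Us; move: X0 Y0 YX => ? ? ?.
by have := @mix_itv _ X (U s) (- Y) t t01; lra.
Qed.

Let cN t : 0 <= t <= 1 -> segment_convex x x' (N t).
Proof.
move=> t01; apply: segment_convexD; apply: (segment_convex_comp cf) => s.
- by rewrite /U; ring.
- by move=> sI; case: (mixN t01 sI).
- by rewrite /U; ring.
- by move=> /rI sI; case: (mixN t01 sI).
Qed.

Let cM t : 0 <= t <= 1 -> segment_convex x x' (M t).
Proof.
move=> t01; apply: segment_convexD; apply: (segment_convex_comp cf) => s.
- by rewrite /U; ring.
- by move=> /rI sI; case: (mixM t01 sI).
- by rewrite /U; ring.
- by move=> sI; case: (mixM t01 sI).
Qed.

Let cI1 t : 0 <= t <= 1 -> segment_convex x x' (I1 t).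
Proof.
move=> t01; apply: segment_convexD; apply: (segment_convex_comp cf) => s.
- by rewrite /U; ring.
- by move=> sI; case: (mixI1 t01 sI).
- by rewrite /U; ring.
- by move=> /rI sI; case: (mixI1 t01 sI).
Qed.

Let cI2 t : 0 <= t <= 1 -> segment_convex x x' (I2 t).
Proof.
move=> t01; apply: segment_convexD; apply: (segment_convex_comp cf) => s.
- by rewrite /U; ring.
- by move=> sI; case: (mixI2 t01 sI).
- by rewrite /U; ring.
- by move=> /rI sI; case: (mixI2 t01 sI).
Qed.

(** The reflection exchanges [U s] and [U (r s)], so each f(c - w) meets its mirror image f(c +
    w). *)
Let symN t s : N t s + N t (r s) =
  phi (t * X + (1 - t) * U s) + phi (t * X + (1 - t) * U (r s)).
Proof. by rewrite /N rr /sym_sum; ring. Qed.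

Let symM t s : M t s + M t (r s) =
  phi (t * X - (1 - t) * U s) + phi (t * X - (1 - t) * U (r s)).
Proof. by rewrite /M rr /sym_sum; ring. Qed.

Let symI1 t s : I1 t s + I1 t (r s) =
  phi (t * U s + (1 - t) * Y) + phi (t * U (r s) + (1 - t) * Y).
Proof. by rewrite /I1 rr /sym_sum; ring. Qed.

Let symI2 t s : I2 t s + I2 t (r s) =
  phi (t * U s - (1 - t) * Y) + phi (t * U (r s) - (1 - t) * Y).
Proof. by rewrite /I2 rr /sym_sum; ring. Qed.

Let lint0 D : lint D (fun s => (fun=> 0) s * p s) = 0.
Proof.
rewrite /lint; under eq_Rintegral do rewrite mul0r.
by rewrite /Rintegral integral0.
Qed.

Let le_sym h g C : segment_convex x x' h -> segment_convex x x' g ->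
  (forall s, x <= s <= x' -> h s + h (r s) <= g s + g (r s) + 2 * C) ->
  lint `[x, x'] (fun s => h s * p s) <=
    lint `[x, x'] (fun s => g s * p s) + C * lint `[x, x'] p.
Proof. by move=> ch cg; apply: le_lint_sym => //; exact: lintegrable_convexM. Qed.

Let zero_convex : segment_convex x x' (fun=> 0).
Proof. by move=> u v k _ _ _; lra. Qed.

Lemma Np_sub_G1_bounds t : 0 <= t <= 1 ->
  0 <= Np f p alpha x x' t - 2 * G1 f x x' y y' t * lint `[x, x'] p
    <= (f x + f x') * lint `[x, x'] p - Np f p alpha x x' t.
Proof.
move=> t01; rewrite NpE /G1.
have -> : 2 * (2^-1 * (f (t * x + (1 - t) * y) + f (t * x' + (1 - t) * y'))) =
  phi (t * X + (1 - t) * Y).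
  rewrite mulrA mulfV// mul1r addrC /sym_sum; congr (f _ + f _); ring.
(* Comparing with the zero function puts the value [2 * G1], independent of [s], into the constant
   of [le_sym]. *)
have lo : lint `[x, x'] (fun s => (fun=> 0) s * p s) <=
   lint `[x, x'] (fun s => N t s * p s) + (- phi (t * X + (1 - t) * Y)) * lint `[x, x'] p.
  apply: le_sym => //; first exact: cN.
  move=> s sI; rewrite symN.
  have H u : Y <= u <= X -> phi (t * X + (1 - t) * Y) <= phi (t * X + (1 - t) * u).
    move=> uI; move: X0 Y0 => ? ?.
    have ? : 0 <= t * X by apply: mulr_ge0; lra.
    have ? : 0 <= (1 - t) * Y by apply: mulr_ge0; lra.
    have ? : 0 <= (1 - t) * (u - Y) by apply: mulr_ge0; lra.
    have ? : 0 <= (1 - t) * (X - u) by apply: mulr_ge0; lra.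
    by apply: (sym_sum_le cf); rewrite ?ger0_norm; lra.
  by have := H _ (Ubound sI); have := H _ (Ubound (rI sI)); lra.
have hi : lint `[x, x'] (fun s => N t s * p s) <= lint `[x, x'] (fun s => (fun=> 0) s * p s)
    + ((f x + f x' + phi (t * X + (1 - t) * Y)) / 2) * lint `[x, x'] p.
  apply: le_sym => //; first exact: cN.
  move=> s sI; rewrite symN.
  have := Ubound sI; have := Ubound (rI sI); have UU := Ur s => U1 U2.
  move: X0 Y0 => ? ?.
  have ? : 0 <= t * X by apply: mulr_ge0; lra.
  have ? : 0 <= (1 - t) * Y by apply: mulr_ge0; lra.
  have ? : 0 <= (1 - t) * (U s - Y) by apply: mulr_ge0; lra.
  have ? : 0 <= (1 - t) * (X - U s) by apply: mulr_ge0; lra.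
  have ? : 0 <= (1 - t) * (U (r s) - Y) by apply: mulr_ge0; lra.
  have ? : 0 <= (1 - t) * (X - U (r s)) by apply: mulr_ge0; lra.
  (* By [Ur] the arguments on both sides sum to (1+t)X + (1-t)Y; moreover phi X = f x + f x'. *)
  have H : phi (t * X + (1 - t) * U s) + phi (t * X + (1 - t) * U (r s))
     <= phi (t * X + (1 - t) * Y) + phi X.
    apply: (sym_sum_pair cf); try lra.
    by have -> : U (r s) = X + Y - U s; [lra|ring].
  by rewrite /sym_sum in H *; lra.
by move: lo hi; rewrite lint0; lra.
Qed.

Variables K0 K1 : R.
Hypothesis slopef : forall u v, x <= u -> u <= v -> v <= x' ->
  K0 * (v - u) <= f v - f u <= K1 * (v - u).

(** The arguments tX + (1-t)U and tU + (1-t)Y differ by t(X - U) + (1-t)(U - Y), which lies between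
    0 and X - Y = y - x. *)
Lemma Np_sub_Ip1_bounds t : 0 <= t <= 1 ->
  0 <= Np f p alpha x x' t - Ip1 f p alpha x x' y y' t
    <= (y - x) * (K1 - K0) * lint `[x, x'] p.
Proof.
move=> t01; rewrite NpE Ip1E.
have key s : x <= s <= x' ->
    0 <= phi (t * X + (1 - t) * U s) - phi (t * U s + (1 - t) * Y) <= (y - x) * (K1 - K0).
  move=> /Ubound Us; move: X0 Y0 (slopes_le X0 slopef) => ? ? K01.
  have ? : 0 <= t * Y by apply: mulr_ge0; lra.
  have ? : 0 <= (1 - t) * Y by apply: mulr_ge0; lra.
  have ? : 0 <= t * (U s - Y) by apply: mulr_ge0; lra.
  have ? : 0 <= (1 - t) * (U s - Y) by apply: mulr_ge0; lra.
  have ? : 0 <= t * (X - U s) by apply: mulr_ge0; lra.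
  have ? : 0 <= (1 - t) * (X - U s) by apply: mulr_ge0; lra.
  rewrite subr_ge0; apply/andP; split.
    by apply: (sym_sum_le cf); rewrite ?ger0_norm; lra.
  apply: le_trans (sym_sum_lip slopef _ _ _) _; try lra.
  rewrite mulrC; apply: ler_wpM2r; lra.
have lo : lint `[x, x'] (fun s => I1 t s * p s) <=
   lint `[x, x'] (fun s => N t s * p s) + 0 * lint `[x, x'] p.
  apply: le_sym; [exact: cI1|exact: cN|move=> s sI].
  by rewrite symN symI1; have := key _ sI; have := key _ (rI sI); lra.
have hi : lint `[x, x'] (fun s => N t s * p s) <=
   lint `[x, x'] (fun s => I1 t s * p s) + (y - x) * (K1 - K0) * lint `[x, x'] p.
  apply: le_sym; [exact: cN|exact: cI1|move=> s sI].
  by rewrite symN symI1; have := key _ sI; have := key _ (rI sI); lra.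
by move: lo hi; lra.
Qed.

(** This is [sym_sum_spread] and [sym_sum_spread_lip] at [U s] and [U (r s)]. The constant fits
    because 4x' - y - 3y' = 2(2X - Y). *)
Lemma Sp_sub_Ip_bounds t : 0 <= t <= 1 ->
  0 <= Sp f p alpha x x' t
       - (Ip1 f p alpha x x' y y' t + Ip2 f p alpha x x' y y' t) / 2
    <= (4 * x' - y - 3 * y') / 4 * (K1 - K0) * lint `[x, x'] p.
Proof.
move=> t01; rewrite SpE Ip1E Ip2E.
have mI := @measurable_cleb_itv R `[x, x'].
pose J s := 2^-1 * (I1 t s + I2 t s).
have cJ : segment_convex x x' J.
  by apply: segment_convexZ; [lra|apply: segment_convexD; [exact: cI1|exact: cI2]].
have cS : segment_convex x x' (S t).
  by apply: segment_convexZ; [lra|apply: segment_convexD; [exact: cN|exact: cM]].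
have -> : (lint `[x, x'] (fun s => I1 t s * p s) + lint `[x, x'] (fun s => I2 t s * p s)) / 2
    = lint `[x, x'] (fun s => J s * p s).
  have i1 := lintegrable_convexM (cI1 t01) ip; have i2 := lintegrable_convexM (cI2 t01) ip.
  rewrite -lintD// mulrC -lintZ//; last exact: lintegrableD.
  by apply: eq_lint => s _; rewrite /J; ring.
have key s : x <= s <= x' ->
    0 <= phi (t * X + (1 - t) * U s) + phi (t * X - (1 - t) * U s)
      - (phi (t * U s + (1 - t) * Y) + phi (t * U s - (1 - t) * Y))
      <= (K1 - K0) * (2 * X - Y).
  move=> /Ubound /andP[YU UX]; rewrite subr_ge0.
  by rewrite (sym_sum_spread cf)//= (sym_sum_spread_lip cf X0 slopef).
have lo : lint `[x, x'] (fun s => J s * p s) <=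
   lint `[x, x'] (fun s => S t s * p s) + 0 * lint `[x, x'] p.
  apply: le_sym => // s sI.
  have := symN t s; have := symM t s; have := symI1 t s; have := symI2 t s.
  by rewrite /S /J; have := key _ sI; have := key _ (rI sI); lra.
have hi : lint `[x, x'] (fun s => S t s * p s) <=
   lint `[x, x'] (fun s => J s * p s)
     + (4 * x' - y - 3 * y') / 4 * (K1 - K0) * lint `[x, x'] p.
  apply: le_sym => // s sI.
  have := symN t s; have := symM t s; have := symI1 t s; have := symI2 t s.
  by rewrite /S /J; have := key _ sI; have := key _ (rI sI); lra.
by move: lo hi; lra.
Qed.

Let lintegrable_sub a b h : x <= a -> b <= x' -> segment_convex x x' h ->
  lintegrable `[a, b] (fun s => h s * p s).
Proof.
move=> xa bx' ch; apply: lintegrableS (lintegrable_convexM ch ip);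
  try exact: measurable_cleb_itv.
by move=> s /=; rewrite !in_itv/=; lra.
Qed.

(** The reflection folds [y', x'] onto [x, y] and preserves the weight. *)
Let lint_Omega h : segment_convex x x' h ->
  lint (Omega x x' y y') (fun s => h s * p s) =
  lint `[x, y] (fun s => (h s + h (r s)) * p s).
Proof.
move=> ch; move: Y0 YX => ? ?; have mI a b := @measurable_cleb_itv R `[a, b].
have i1 : lintegrable `[x, y] (fun s => h s * p s) by apply: lintegrable_sub => //; lra.
have i2 : lintegrable `[y', x'] (fun s => h s * p s) by apply: lintegrable_sub => //; lra.
have xE : x = x + x' - x' by ring.
have yE : y = x + x' - y' by ring.
have i3 := lintegrable_reflect_itv xE yE i2.
rewrite /Omega lint_itvU; first last.
- apply: lintegrableS (lintegrable_convexM ch ip) => //; first exact: measurableU.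
  by move=> s /=; rewrite !in_itv/=; lra.
- by lra.
rewrite (lint_reflect_itv xE yE i2) -lintD//; apply: eq_lint => s /=; rewrite in_itv/= => sI.
by rewrite mulrDl -ps// in_itv/=; lra.
Qed.

(** With S = c - s in [Y, X], the integrands over [x, y] are values of [phi]: at [A] for Pp1, at [C]
    for Hp1, at [D] for Hp2; folding Lp1 gives [A] and [B]. *)
Let A t s := t * X + (1 - t) * (c - s).
Let B t s := t * X - (1 - t) * (c - s).
Let C t s := t * (c - s) + (1 - t) * Y.
Let D t s := t * (c - s) - (1 - t) * Y.

Let Sbound s : x <= s <= y -> Y <= c - s <= X.
Proof. by lra. Qed.

Let cphi (E : R -> R) : (forall s, E s = (E 1 - E 0) * s + E 0) ->
  (forall s, x <= s <= y -> - X <= E s <= X) -> segment_convex x y (fun s => phi (E s)).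
Proof. by move=> EE EX; exact: (segment_convex_comp (sym_sum_convex cf)). Qed.

Let cA t : 0 <= t <= 1 -> segment_convex x y (fun s => phi (A t s)).
Proof.
move=> t01; apply: cphi => s; first by rewrite /A; ring.
by move: X0 Y0 => ? ? ?; apply: mix_itv => //; lra.
Qed.

Let cB t : 0 <= t <= 1 -> segment_convex x y (fun s => phi (B t s)).
Proof.
move=> t01; apply: cphi => s; first by rewrite /B; ring.
by move: X0 Y0 => ? ? ?; rewrite /B -mulrN; apply: mix_itv => //; lra.
Qed.

Let cC t : 0 <= t <= 1 -> segment_convex x y (fun s => phi (C t s)).
Proof.
move=> t01; apply: cphi => s; first by rewrite /C; ring.
by move: X0 Y0 YX => ? ? ? ?; apply: mix_itv => //; lra.
Qed.

Let cD t : 0 <= t <= 1 -> segment_convex x y (fun s => phi (D t s)).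
Proof.
move=> t01; apply: cphi => s; first by rewrite /D; ring.
by move: X0 Y0 YX => ? ? ? ?; rewrite /D -mulrN; apply: mix_itv => //; lra.
Qed.

Let Hp1E t : Hp1 f p x y y' t = lint `[x, y] (fun s => phi (C t s) * p s).
Proof.
rewrite /Hp1; congr lint; apply/funext => s.
rewrite /sym_sum /C addrC; congr ((f _ + f _) * _); ring.
Qed.

Let Hp2E t : Hp2 f p x y y' t = lint `[x, y] (fun s => phi (D t s) * p s).
Proof.
rewrite /Hp2; congr lint; apply/funext => s.
rewrite /sym_sum /D addrC; congr ((f _ + f _) * _); ring.
Qed.

Let Pp1E t : Pp1 f p x x' y t = lint `[x, y] (fun s => phi (A t s) * p s).
Proof.
rewrite /Pp1; congr lint; apply/funext => s.
rewrite /sym_sum /A addrC; congr ((f _ + f _) * _); ring.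
Qed.

Let Lp1E t : 0 <= t <= 1 -> Lp1 f p x x' y y' t =
  lint `[x, y] (fun s => (2^-1 * (phi (A t s) + phi (B t s))) * p s).
Proof.
move=> t01; move: Y0 X0 => ? ?; have mJ := @measurable_cleb_itv R `[x, y].
pose h s := f (t * x + (1 - t) * s) + f (t * x' + (1 - t) * s).
have ch : segment_convex x x' h.
  apply: segment_convexD; apply: (segment_convex_comp cf) => s; try by ring.
  - by move=> sI; have := @mix_itv _ X (- X) (s - c) t t01; lra.
  - by move=> sI; have := @mix_itv _ X X (s - c) t t01; lra.
transitivity (2^-1 * lint `[x, y] (fun s => (h s + h (r s)) * p s)).
  by rewrite -(lint_Omega ch).
have hE s : h s + h (r s) = phi (A t s) + phi (B t s).
  rewrite /h /sym_sum /A /B.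
  rewrite (_ : t * x + (1 - t) * s = c - (t * X + (1 - t) * (c - s))); last by ring.
  rewrite (_ : t * x' + (1 - t) * s = c + (t * X - (1 - t) * (c - s))); last by ring.
  rewrite (_ : t * x + (1 - t) * r s = c - (t * X - (1 - t) * (c - s))); last by ring.
  rewrite (_ : t * x' + (1 - t) * r s = c + (t * X + (1 - t) * (c - s))); last by ring.
  by ring.
under eq_lint do rewrite hE.
rewrite -lintZ//; first by apply: eq_lint => s _; rewrite mulrA.
apply: lintegrable_convexM; first by apply: segment_convexD; [exact: cA|exact: cB].
apply: lintegrableS ip; try exact: measurable_cleb_itv.
by move=> s /=; rewrite !in_itv/=; lra.
Qed.

Lemma Lp1_bounds t : 0 <= t <= 1 ->
  (0 <= Lp1 f p x x' y y' t - (Hp1 f p x y y' t + Hp2 f p x y y' t) / 2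
     <= (4 * x' - y - 3 * y') / 8 * (K1 - K0) * lint (Omega x x' y y') p)
  /\
  (0 <= Pp1 f p x x' y t - Lp1 f p x x' y y' t
     <= (4 * x' - y - 3 * y') / 8 * (K1 - K0) * lint (Omega x x' y y') p).
Proof.
move=> t01; have mJ := @measurable_cleb_itv R `[x, y].
have ipJ : lintegrable `[x, y] p.
  apply: lintegrableS ip; try exact: measurable_cleb_itv.
  by move: Y0 X0 => ? ? s /=; rewrite !in_itv/=; lra.
have p0J s : (`[x, y]%classic : set R) s -> 0 <= p s.
  by rewrite /= in_itv/= => sI; apply: p0; rewrite in_itv/=; move: Y0 X0; lra.
(* Folding the weight itself, with [h] constantly 1, turns the pointwise factor 1/4 into the stated
   1/8. *)
have -> : lint (Omega x x' y y') p = 2 * lint `[x, y] p.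
  have := @lint_Omega (fun=> 1).
  under eq_lint do rewrite mul1r.
  move=> ->; last by move=> u v k _ _ _; lra.
  by rewrite -lintZ.
pose L s := 2^-1 * (phi (A t s) + phi (B t s)).
pose H s := 2^-1 * (phi (C t s) + phi (D t s)).
have cL : segment_convex x y L.
  by apply: segment_convexZ; [lra|apply: segment_convexD; [exact: cA|exact: cB]].
have cH : segment_convex x y H.
  by apply: segment_convexZ; [lra|apply: segment_convexD; [exact: cC|exact: cD]].
have -> : Lp1 f p x x' y y' t = lint `[x, y] (fun s => L s * p s) by exact: Lp1E.
rewrite Pp1E Hp1E Hp2E.
have -> : (lint `[x, y] (fun s => phi (C t s) * p s)
    + lint `[x, y] (fun s => phi (D t s) * p s)) / 2 = lint `[x, y] (fun s => H s * p s).
  have i1 := lintegrable_convexM (cC t01) ipJ; have i2 := lintegrable_convexM (cD t01) ipJ.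
  rewrite -lintD// mulrC -lintZ//; last exact: lintegrableD.
  by apply: eq_lint => s _; rewrite /H; ring.
have le_int g h K : segment_convex x y h -> segment_convex x y g ->
  (forall s, x <= s <= y -> h s <= g s + K) ->
  lint `[x, y] (fun s => h s * p s) <=
    lint `[x, y] (fun s => g s * p s) + K * lint `[x, y] p.
  by move=> ch cg hg; apply: le_lint_affine => //; exact: lintegrable_convexM.
have keyLH s : x <= s <= y -> 0 <= L s - H s <= (4 * x' - y - 3 * y') / 4 * (K1 - K0).
  move=> /Sbound/andP[YS SX].
  have := sym_sum_spread cf Y0 YS SX t01.
  have := sym_sum_spread_lip cf X0 slopef Y0 YS SX t01.
  by rewrite /L /H /A /B /C /D; lra.
have keyPL s : x <= s <= y -> 0 <= phi (A t s) - L s <= (4 * x' - y - 3 * y') / 4 * (K1 - K0).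
  move=> /Sbound/andP[YS SX]; move: Y0 YX X0 (slopes_le X0 slopef) => ? ? ? K01.
  have S0 : 0 <= c - s by lra.
  have := sym_sum_cross_lip X0 slopef S0 SX t01.
  have : phi (B t s) <= phi (A t s).
    case/andP: t01 => t0 t1.
    have ? : 0 <= t * X by apply: mulr_ge0; lra.
    have ? : 0 <= t * (X - (c - s)) by apply: mulr_ge0; lra.
    have ? : 0 <= (1 - t) * (X - (c - s)) by apply: mulr_ge0; lra.
    have ? : 0 <= (1 - t) * (c - s) by apply: mulr_ge0; lra.
    by apply: (sym_sum_le cf); rewrite ?ler_norml /A /B; lra.
  (* [sym_sum_cross_lip] gives the constant [X], which is enlarged to [2 * X - Y]. *)
  have : 0 <= (K1 - K0) * (X - Y) by apply: mulr_ge0; lra.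
  by rewrite /L /A /B; lra.
pose K := (4 * x' - y - 3 * y') / 4 * (K1 - K0).
have H_le_L := le_int L H 0 cH cL; have L_le_H := le_int H L K cL cH.
have L_le_P := le_int _ L 0 cL (cA t01); have P_le_L := le_int L _ K (cA t01) cL.
have d1 : lint `[x, y] (fun s => H s * p s) <=
    lint `[x, y] (fun s => L s * p s) + 0 * lint `[x, y] p.
  by apply: H_le_L => s /keyLH; lra.
have d2 : lint `[x, y] (fun s => L s * p s) <=
    lint `[x, y] (fun s => H s * p s) + K * lint `[x, y] p.
  by apply: L_le_H => s /keyLH; rewrite /K; lra.
have d3 : lint `[x, y] (fun s => L s * p s) <=
    lint `[x, y] (fun s => phi (A t s) * p s) + 0 * lint `[x, y] p.
  by apply: L_le_P => s /keyPL; lra.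
have d4 : lint `[x, y] (fun s => phi (A t s) * p s) <=
    lint `[x, y] (fun s => L s * p s) + K * lint `[x, y] p.
  by apply: P_le_L => s /keyPL; rewrite /K; lra.
move: d1 d2 d3 d4; rewrite /K.
set iL := lint _ (fun s => L s * p s); set iH := lint _ (fun s => H s * p s).
set iP := lint _ (fun s => phi (A t s) * p s); set i1 := lint _ p.
by move=> d1 d2 d3 d4; split; lra.
Qed.

End weighted_inequalities.

(** * From the stated hypotheses to the centred setting *)

Lemma convex_function_segment (R : realType) (a b x x' : R) (f : R -> R) :
  a <= x -> x' <= b -> @convex_function R R^o [set` `[a, b]] f ->
  segment_convex x x' f.
Proof.
move=> ax xb cf u v k ux vx /andP[k0 k1].
have := cf (Itv01 k0 k1) u v.
rewrite !inE/= !in_itv/= !convRE/=.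
by apply; lra.
Qed.

(** The end derivatives need only the pieces of [E] next to [x] and [x']; convexity carries the
    slope bounds across any gap, so this covers both Omega and [x, x']. *)
Lemma differentiable_on_slopes (R : realType) (x y y' x' : R) (E : set R) (f : R -> R) :
  x < y -> y <= x' -> x <= y' -> y' < x' -> `[x, y] `<=` E -> `[y', x'] `<=` E ->
  segment_convex x x' f -> differentiable_on E f ->
  forall u v, x <= u -> u <= v -> v <= x' ->
  deriv_on E f x * (v - u) <= f v - f u <= deriv_on E f x' * (v - u).
Proof.
move=> xy yx' xy' y'x' xyE y'x'E cf df u v xu uv vx'.
rewrite (slope_ge_right_deriv xy yx' xyE cf)//; last first.
  by apply/df/xyE; rewrite /= in_itv/=; lra.
rewrite (slope_le_left_deriv xy' y'x' y'x'E cf)//.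
by apply/df/y'x'E; rewrite /= in_itv/=; lra.
Qed.

Unset Implicit Arguments.

Theorem theorem21 (R : realType) (a b x x' alpha : R) (f p : R -> R)
  (hax : a <= x) (hxx' : x < x') (hx'b : x' <= b)
  (halpha0 : 0 < alpha) (halpha : alpha <= 2^-1)
  (hf : @convex_function R R^o [set` `[a, b]] f)
  (hp0 : forall s, s \in `[x, x'] -> 0 <= p s)
  (hpint : lintegrable `[x, x'] p)
  (hpsym : symmetric_weight x x' p) :
  let y := (1 - alpha) * x + alpha * x' in
  let y' := alpha * x + (1 - alpha) * x' in
  let m' := if y != y' then 2^-1 else 0 in
  let Om := Omega x x' y y' in
  let I := [set` `[x, x']] in
  (forall t, t \in `[0, 1] ->
     0 <= Np f p alpha x x' t - 2 * G1 f x x' y y' t * lint I p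
       <= (f x + f x') * lint I p - Np f p alpha x x' t)
  /\
  (differentiable_on Om f ->
   forall t, t \in `[0, 1] ->
     (0 <= Lp1 f p x x' y y' t - (Hp1 f p x y y' t + Hp2 f p x y y' t) / 2
        <= (4 * x' - y - 3 * y') / 8
           * (deriv_on Om f x' - deriv_on Om f x) * lint Om p)
     /\
     (0 <= Pp1 f p x x' y t - Lp1 f p x x' y y' t
        <= (4 * x' - y - 3 * y') / 8
           * (deriv_on Om f x' - deriv_on Om f x) * lint Om p))
  /\
  (differentiable_on I f ->
   (forall t, t \in `[0, 1] ->
      0 <= Np f p alpha x x' t - Ip1 f p alpha x x' y y' t
        <= (y - x) * (deriv_on I f x' - deriv_on I f x) * lint I p)
   /\
   (forall t, t \in `[m', 1] ->
      0 <= Sp f p alpha x x' t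
           - (Ip1 f p alpha x x' y y' t + Ip2 f p alpha x x' y y' t) / 2
        <= (4 * x' - y - 3 * y') / 4
           * (deriv_on I f x' - deriv_on I f x) * lint I p)).
Proof.
have [c [X [xE x'E]]] : exists c X, x = c - X /\ x' = c + X.
  by exists ((x + x') / 2), ((x' - x) / 2); split; field.
subst x x'; have X0 : 0 < X by lra.
have cf := convex_function_segment hax hx'b hf.
move=> y y' m' Om I.
pose Y := (1 - 2 * alpha) * X.
have yE : y = c - Y by rewrite /y /Y; ring.
have y'E : y' = c + Y by rewrite /y' /Y; ring.
have Y0 : 0 <= Y by rewrite mulr_ge0//; lra.
have aX : 0 < alpha * X by rewrite mulr_gt0.
have YX : Y < X by rewrite /Y; lra.
have m0 : 0 <= m' by rewrite /m'; case: ifP => _; lra.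
clearbody m'; rewrite /Om; clearbody y y'; subst y y' => {Om}.
split; last split.
- move=> t; rewrite in_itv/= => t01.
  exact: (Np_sub_G1_bounds X0 halpha0 halpha (erefl _) cf hp0 hpint hpsym t01).
- move=> df t; rewrite in_itv/= => t01.
  apply: (Lp1_bounds X0 halpha0 halpha (erefl _) cf hp0 hpint hpsym _ t01).
  apply: (differentiable_on_slopes (y := c - Y) (y' := c + Y)) => //; try lra.
    by move=> s sJ; left.
  by move=> s sJ; right.
- move=> df; have slope : forall u v, c - X <= u -> u <= v -> v <= c + X ->
      deriv_on I f (c - X) * (v - u) <= f v - f u <= deriv_on I f (c + X) * (v - u).
    (* Here both end pieces are the whole segment. *)
    by apply: (differentiable_on_slopes (y := c + X) (y' := c - X)) => //; lra.
  split=> t; rewrite in_itv/= => t01.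
    exact: (Np_sub_Ip1_bounds X0 halpha0 halpha (erefl _) cf hp0 hpint hpsym slope t01).
  apply: (Sp_sub_Ip_bounds X0 halpha0 halpha (erefl _) cf hp0 hpint hpsym slope).
  by lra.
Qed.
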